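(* Let $\mathcal{V}$ and $\mathcal{U}$ be real vector spaces of finite dimension endowed with inner products $\langle\cdot,\cdot\rangle_{\mathcal{V}}$ and $\langle\cdot,\cdot\rangle_{\mathcal{U}}$, and let $F\colon\mathcal{V}\to\mathcal{U}$ be a linear map with adjoint $F^t\colon\mathcal{U}\to\mathcal{V}$, defined by the property $\langle Fv,u\rangle_{\mathcal{U}}=\langle v,F^tu\rangle_{\mathcal{V}}$ for all $v\in\mathcal{V}$, $u\in\mathcal{U}$. Then there is a unique decomposition (the singular value decomposition, SVD) $$F=\sum_{i=1}^k\sigma_iF_i$$ with $\sigma_1>\ldots>\sigma_k>0$ and $F_i\colon\mathcal{V}\to\mathcal{U}$ linear maps such that: (1) $F_iF_j^t$ and $F_i^tF_j$ are both zero for any $i\neq j$; (2) the restriction ${F_i}_{|\mathrm{Im}(F_i^t)}\colon \mathrm{Im}(F_i^t)\to \mathrm{Im}(F_i)$ is an isometry with inverse $F_i^t$. Both the singular values $\sigma_i$ and the linear maps $F_i$ are uniquely determined from $F$.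
   Context: For each linear map $F_i\colon\mathcal{V}\to\mathcal{U}$, $F_i^t\colon\mathcal{U}\to\mathcal{V}$ denotes its adjoint with respect to the given inner products, and $\mathrm{Im}$ denotes the image. An isometry is a linear bijection preserving the inner products (restricted to the subspaces in question); in (2), the inverse is $F_i^t$ regarded as a map $\mathrm{Im}(F_i)\to\mathrm{Im}(F_i^t)$. The numbers $\sigma_i$ are called the singular values of $F$.
   Formalization: The maps F_i are additionally required to be nonzero; otherwise uniqueness fails, since zero terms (e.g. 0 = 5·0) satisfy (1) and (2) and could be inserted freely. *)

(* Defs.v *)
From HB Require Import structures.
From mathcomp Require Import all_boot all_order all_algebra.
From mathcomp Require Import sesquilinear reals.

Set Implicit Arguments.
Unset Strict Implicit.
Unset Printing Implicit Defensive.

Import Order.TTheory GRing.Theory Num.Theory.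

Local Open Scope ring_scope.

(* An inner product on a real vector space V is an element of
   {dot V for idfun}, i.e. a symmetric positive definite bilinear form. *)

Section Adjoint.

Variables (R : realType) (V U : vectType R).
Variables (dV : {dot V for idfun}) (dU : {dot U for idfun}).
Implicit Types (v w : V) (u : U) (F : 'Hom(V, U)) (G : 'Hom(U, V)).

Definition is_adjoint F G : Prop := forall v u, dU (F v) u = dV v (G u).

Definition riesz : 'Hom(V, 'Hom(V, R^o)) :=
  linfun (fun w => linfun (fun v => dV v w : R^o)).

(* By the Riesz isomorphism, adjoint F u is the vector representing the
   functional v |-> dU (F v) u.  It is the unique G with is_adjoint F G, see
   adjointP and adjoint_uniq below. *)
Definition adjoint F : 'Hom(U, V) :=
  linfun (fun u => (riesz^-1)%VF (linfun (fun v => dU (F v) u : R^o))).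

Lemma linfunE_linear (aT rT : vectType R) (f : aT -> rT) :
  linear f -> linfun f =1 f.
Proof.
move=> lf; pose L := GRing.isLinear.Build _ _ _ _ f lf.
pose g : {linear aT -> rT} := HB.pack f L.
by move=> x; exact: (lfunE g).
Qed.

Lemma functionalE F u v : (linfun (fun v => dU (F v) u : R^o)) v = dU (F v) u.
Proof. by rewrite linfunE_linear // => a x y; rewrite linearP linearPl. Qed.

Lemma functional_linear F :
  linear (fun u => linfun (fun v => dU (F v) u : R^o) : 'Hom(V, R^o)).
Proof.
by move=> a x y; apply/lfunP => v; rewrite !lfun_simp !functionalE linearPr.
Qed.

Lemma rieszE w v : riesz w v = dV v w.
Proof.
rewrite /riesz !linfunE_linear //.
- by move=> a x y; rewrite linearPl.
- move=> a x y; apply/lfunP => t.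
  by rewrite !lfun_simp !linfunE_linear ?linearPr // => b p q; rewrite linearPl.
Qed.

Lemma dot_inj w w' : (forall v, dV v w = dV v w') -> w = w'.
Proof.
move=> E; apply/eqP; rewrite -subr_eq0; apply/negP => /negP nz.
have := neq0_dnorm_gt0 (s := dV) _ nz.
by rewrite linearB /= E subrr ltxx.
Qed.

Lemma rieszK (f : 'Hom(V, R^o)) v : dV v ((riesz^-1)%VF f) = f v.
Proof.
rewrite -rieszE limg_lfunVK //.
suff -> : limg riesz = fullv by rewrite memvf.
apply/eqP; rewrite eqEdim subvf /= limg_dim_eq.
  by rewrite !dimvf /dim /= muln1.
have k0 : lker riesz == 0%VS.
  by apply/lker0P => x y E; apply: dot_inj => z; rewrite -!rieszE E.
by rewrite (eqP k0) capv0.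
Qed.

Lemma adjointP F : is_adjoint F (adjoint F).
Proof.
move=> v u; rewrite /adjoint linfunE_linear ?rieszK ?functionalE //.
by move=> a x y; rewrite -linearP; congr (_ _); exact: functional_linear.
Qed.

Lemma adjoint_uniq F G : is_adjoint F G -> G = adjoint F.
Proof.
by move=> FG; apply/lfunP => u; apply: dot_inj => v; rewrite -FG -adjointP.
Qed.

End Adjoint.

Section SVD.

Variables (R : realType) (V U : vectType R).
Variables (dV : {dot V for idfun}) (dU : {dot U for idfun}).

(* f restricts to an isometry A -> B with inverse the restriction of g *)
Definition isometry_with_inverse (A : {vspace V}) (B : {vspace U})
    (f : 'Hom(V, U)) (g : 'Hom(U, V)) : Prop :=
  [/\ (f @: A)%VS = B, (g @: B)%VS = A,
      {in A, cancel f g}, {in B, cancel g f} &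
      {in A &, isometry dU dV f}].

(* The maps F_i are required to be nonzero: otherwise a term sigma_i * 0
   could be inserted freely and the decomposition would not be unique. *)
Definition is_svd (F : 'Hom(V, U)) (k : nat)
    (sigma : 'I_k -> R) (Fs : 'I_k -> 'Hom(V, U)) : Prop :=
  let adj := adjoint dV dU in
  [/\ F = \sum_(i < k) sigma i *: Fs i,
      forall i j : 'I_k, (i < j)%N -> sigma j < sigma i,
      forall i, 0 < sigma i /\ Fs i != 0,
      forall i j, i != j ->
        (Fs i \o adj (Fs j))%VF = 0 /\ (adj (Fs i) \o Fs j)%VF = 0 &
      forall i, isometry_with_inverse (limg (adj (Fs i))) (limg (Fs i))
                  (Fs i) (adj (Fs i))].

End SVD.

(* Main.v *)
Require Import Defs.
From HB Require Import structures.
From mathcomp Require Import all_boot all_order all_algebra.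
From mathcomp Require Import sesquilinear reals.
From mathcomp Require Import complex ring.

Set Implicit Arguments.
Unset Strict Implicit.

Import Order.TTheory GRing.Theory Num.Theory.

Local Open Scope ring_scope.

(* Let A = F^t F. Being self-adjoint, A is annihilated by a product of distinct
   real linear factors X - t (t in s), so a polynomial in A depends only on its
   values on s. With q_t the Lagrange polynomial of t on s, the projections
   P_t = q_t(A) sum to 1 and A P_t = t P_t; the maps F_t = t^(-1/2) F P_t, for
   those t with F P_t <> 0, form an SVD. Conversely any SVD satisfies
   F q(A) = \sum_i q(sigma_i^2) sigma_i F_i for every polynomial q, and these
   sums determine the nodes sigma_i^2 and the terms sigma_i F_i. *)

(** * Polynomials in an endomorphism *)

Section PolynomialOfEndomorphism.

Variables (R : fieldType) (V : vectType R) (A : 'End(V)).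
Implicit Types (p q r : {poly R}) (c t : R).

(** Horner's scheme on the coefficient list, with composition as product; it makes sense on the zero
    space too. *)
Definition lfun_horner p : 'End(V) :=
  foldr (fun c B => (B \o A)%VF + c *: \1%VF) 0 p.

Lemma lfun_horner0 : lfun_horner 0 = 0.
Proof. by rewrite /lfun_horner polyseq0. Qed.

Lemma lfun_horner_MXaddC p c :
  lfun_horner (p * 'X + c%:P) = (lfun_horner p \o A)%VF + c *: \1%VF.
Proof.
rewrite -cons_poly_def /lfun_horner polyseq_cons.
(* For [p = 0] the coefficient list is that of the constant [c], which is empty when [c = 0]. *)
case: nilP => //= p0; rewrite polyseqC.
have -> /= : foldr (fun c B => (B \o A)%VF + c *: \1%VF) 0 p = 0 by rewrite p0.
by case: eqP => [->|_] /=; rewrite comp_lfun0l ?scale0r ?addr0.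
Qed.

Lemma lfun_hornerMX p : lfun_horner (p * 'X) = (lfun_horner p \o A)%VF.
Proof. by rewrite -[_ * 'X]addr0 lfun_horner_MXaddC scale0r addr0. Qed.

Lemma lfun_hornerC c : lfun_horner c%:P = c *: \1%VF.
Proof.
by rewrite -[c%:P]add0r -(mul0r 'X) lfun_horner_MXaddC lfun_horner0
  comp_lfun0l add0r.
Qed.

Lemma lfun_hornerX : lfun_horner 'X = A.
Proof. by rewrite -['X]mul1r lfun_hornerMX lfun_hornerC scale1r comp_lfun1l. Qed.

Lemma lfun_hornerD p q : lfun_horner (p + q) = lfun_horner p + lfun_horner q.
Proof.
elim/poly_ind: p q => [|p c IH] q; first by rewrite lfun_horner0 !add0r.
elim/poly_ind: q => [|q d _]; first by rewrite lfun_horner0 !addr0.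
by rewrite addrACA -mulrDl -polyCD !lfun_horner_MXaddC IH comp_lfunDl scalerDl
  addrACA.
Qed.

Lemma lfun_hornerZ c p : lfun_horner (c *: p) = c *: lfun_horner p.
Proof.
elim/poly_ind: p => [|p d IH]; first by rewrite scaler0 lfun_horner0 scaler0.
by rewrite scalerDr scalerAl -[c *: d%:P]mul_polyC -polyCM !lfun_horner_MXaddC
  IH -comp_lfunZl scalerDr scalerA.
Qed.

Lemma lfun_hornerM p q :
  lfun_horner (p * q) = (lfun_horner p \o lfun_horner q)%VF.
Proof.
elim/poly_ind: p q => [|p c IH] q.
  by rewrite mul0r lfun_horner0 comp_lfun0l.
(* Induction on [p] leaves a factor [A] on the wrong side of q(A); the two commute. *)
have comm_A : (A \o lfun_horner q)%VF = (lfun_horner q \o A)%VF.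
  elim/poly_ind: q => [|q d IHq].
    by rewrite lfun_horner0 comp_lfun0l comp_lfun0r.
  rewrite lfun_horner_MXaddC comp_lfunDl comp_lfunDr comp_lfunA IHq.
  by rewrite -comp_lfunZl -comp_lfunZr comp_lfun1l comp_lfun1r.
rewrite mulrDl mulrAC mul_polyC lfun_hornerD lfun_hornerZ lfun_hornerMX IH.
rewrite lfun_horner_MXaddC comp_lfunDl -comp_lfunZl comp_lfun1l.
by rewrite -!comp_lfunA comm_A.
Qed.

Lemma lfun_horner_sum (I : Type) (s : seq I) (P : pred I) (p : I -> {poly R}) :
  lfun_horner (\sum_(i <- s | P i) p i) = \sum_(i <- s | P i) lfun_horner (p i).
Proof. exact: (big_morph _ lfun_hornerD lfun_horner0). Qed.

(** By hypothesis [A] acts on the right of [G] as the scalar [t], so each power of [A] acts as that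
    power of [t]. *)
Lemma comp_lfun_horner (U : vectType R) (G : 'Hom(V, U)) t q :
  (G \o A)%VF = t *: G -> (G \o lfun_horner q)%VF = q.[t] *: G.
Proof.
move=> GA; elim/poly_ind: q => [|q c IH].
  by rewrite lfun_horner0 comp_lfun0r horner0 scale0r.
rewrite lfun_horner_MXaddC comp_lfunDr comp_lfunA IH -comp_lfunZl GA.
by rewrite -comp_lfunZr comp_lfun1r scalerA -scalerDl !hornerE.
Qed.

(** Dimension count: with n = dim End(V), polynomials with n + 1 coefficients form a space too large
    for p -> p(A) to be injective. *)
Lemma lfun_horner_annihilator : exists2 p : {poly R}, p != 0 & lfun_horner p = 0.
Proof.
pose n := dim 'End(V).
pose f := fun u : 'rV[R]_n.+1 => lfun_horner (rVpoly u).
have lin_f : linear f.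
  by move=> c u v; rewrite /f linearP lfun_hornerD lfun_hornerZ.
pose g : {linear 'rV[R]_n.+1 -> 'End(V)} :=
  HB.pack f (GRing.isLinear.Build _ _ _ _ f lin_f).
pose K := lker (linfun g).
have K_neq0 : K != 0%VS.
  apply/negP => /eqP K0.
  have := limg_ker_dim (linfun g) fullv.
  rewrite capfv -/K K0 dimv0 add0n => dim_img.
  have := dimvS (subvf (limg (linfun g))).
  by rewrite dim_img !dimvf /dim /= mul1n ltnn.
exists (rVpoly (vpick K)).
  apply: contra K_neq0 => /eqP p0; rewrite -vpick0.
  by rewrite -[vpick K]rVpolyK p0 linear0.
by have := memv_pick K; rewrite memv_ker lfunE => /eqP.
Qed.

(* Divisibility by [\prod_(x <- s) ('X - x%:P)] is tested on the roots. *)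
Lemma eq_lfun_horner (s : seq R) p q :
  uniq s -> lfun_horner (\prod_(x <- s) ('X - x%:P)) = 0 ->
  {in s, forall x, p.[x] = q.[x]} -> lfun_horner p = lfun_horner q.
Proof.
move=> s_uniq As0 eq_pq.
have [r] : exists r, p - q = r * \prod_(x <- s) ('X - x%:P).
  apply: uniq_roots_prod_XsubC; last by rewrite uniq_rootsE.
  by apply/allP => x xs; rewrite rootE !hornerE eq_pq // subrr.
move/(canRL (subrK q)) ->.
by rewrite lfun_hornerD lfun_hornerM As0 comp_lfun0r add0r.
Qed.

End PolynomialOfEndomorphism.

(** * Lagrange polynomials and real factorisation *)

(** Lagrange basis polynomial of [t] on the nodes [s]. Neither membership of [t] in [s] nor distinct
    entries are assumed, so lists of nodes can be concatenated freely. *)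
Definition node_poly (R : fieldType) (s : seq R) (t : R) : {poly R} :=
  \prod_(y <- s | y != t) ((t - y)^-1 *: ('X - y%:P)).

Lemma horner_node_poly (R : fieldType) (s : seq R) (t x : R) :
  x \in t :: s -> (node_poly s t).[x] = (x == t)%:R.
Proof.
rewrite inE horner_prod; have [-> _|xt /= xs] := eqVneq x t.
  by rewrite big1 // => y yt; rewrite !hornerE mulVf // subr_eq0 eq_sym.
apply/eqP; rewrite prodf_seq_eq0; apply/hasP; exists x => //.
by rewrite xt !hornerE subrr mulr0 eqxx.
Qed.

Lemma size_XsubC_sqrD (R : rcfType) (a c : R) :
  size (('X - a%:P) ^+ 2 + c%:P) = 3%N.
Proof.
have size_sq : size (('X - a%:P) ^+ 2) = 3%N by rewrite size_exp_XsubC.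
by rewrite size_polyDl size_sq // (leq_ltn_trans (size_polyC_leq1 _)).
Qed.

(** Take a complex root a + ib. If b = 0 it gives a linear factor; otherwise the real quadratic with
    roots a + ib and a - ib divides [p], because the remainder has degree at most one and vanishes
    at a nonreal point. *)
Lemma real_poly_factor (R : rcfType) (p : {poly R}) : (1 < size p)%N ->
  exists a b q, p = q * ('X - a%:P) \/
    b != 0 /\ p = q * (('X - a%:P) ^+ 2 + (b ^+ 2)%:P).
Proof.
move=> p_gt1; pose toC := real_complex R.
have /closed_rootP [[a b] pz0] : size (map_poly toC p) != 1.
  by rewrite size_map_poly; case: (size p) p_gt1 => [|[|n]].
exists a, b; have [b0|b_neq0] := eqVneq b 0.
  rewrite b0 complexr0 fmorph_root in pz0.
  by have /factor_theorem [q ->] := pz0; exists q; left.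
have size_d := size_XsubC_sqrD a (b ^+ 2).
set d := _ + (b ^+ 2)%:P in size_d *; exists (p %/ d); right; split=> //.
suff mod0 : p %% d = 0 by rewrite {1}(divp_eq p d) mod0 addr0.
have dz0 : (map_poly toC d).[(a +i* b)%C] = 0.
  rewrite rmorphD rmorphXn /= map_polyXsubC map_polyC !hornerE /=.
  by apply/eqP; rewrite eq_complex /=; apply/andP; split; apply/eqP => /=; ring.
have size_mod : (size (p %% d)%R <= 2)%N.
  by rewrite -ltnS -size_d ltn_modp -size_poly_gt0 size_d.
have : (map_poly toC (p %% d)).[(a +i* b)%C] = 0.
  move: pz0; rewrite {1}(divp_eq p d) rootE rmorphD rmorphM /= hornerD hornerM.
  by rewrite dz0 mulr0 add0r => /eqP.
rewrite (@horner_coef_wide _ 2) ?size_map_poly // !big_ord_recl big_ord0.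
rewrite !coef_map /= addr0 expr0 expr1 mulr1.
move/eqP; rewrite eq_complex /= !mul0r subr0 addr0 add0r.
(* The imaginary part is b times the linear coefficient, so that coefficient vanishes; the real part
   then kills the constant one. *)
move=> /andP[/eqP re0]; rewrite mulf_eq0 (negbTE b_neq0) orbF => /eqP c1.
apply/polyP => -[|[|i]]; rewrite coef0 //.
  by move: re0; rewrite /bump /= c1 mul0r addr0.
by rewrite nth_default // (leq_trans size_mod).
Qed.

(** * Annihilating polynomials of self-adjoint endomorphisms *)

Section SelfAdjoint.

Variables (R : rcfType) (V : vectType R) (dV : {dot V for idfun}).

Lemma dotC x y : dV x y = dV y x.
Proof. by have /= := hermC dV x y; rewrite expr0 mul1r. Qed.

Lemma dot_ge0 x : 0 <= dV x x.
Proof.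
have [->|x0] := eqVneq x 0; first by rewrite linear0l.
exact: ltW (neq0_dnorm_gt0 _ x0).
Qed.

Lemma dot_eq0 x : dV x x = 0 -> x = 0.
Proof.
by apply: contra_eq => x0; apply: lt0r_neq0; exact: neq0_dnorm_gt0.
Qed.

Variable A : 'End(V).
Hypothesis A_sym : forall x y, dV (A x) y = dV x (A y).

(** The adjoint of p(A) A is A p(A), and these agree since [A] commutes with p(A). *)
Lemma lfun_horner_sym (p : {poly R}) x y :
  dV (lfun_horner A p x) y = dV x (lfun_horner A p y).
Proof.
elim/poly_ind: p x y => [|p c IH] x y.
  by rewrite lfun_horner0 !lfunE /= linear0l linear0r.
have commA : (lfun_horner A p \o A)%VF = (A \o lfun_horner A p)%VF.
  by rewrite -lfun_hornerMX mulrC lfun_hornerM lfun_hornerX.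
rewrite lfun_horner_MXaddC !lfun_simp linearDl linearDr /= IH A_sym.
rewrite -[A (lfun_horner _ _ _)]comp_lfunE -commA comp_lfunE.
by rewrite linearZl_LR linearZr_LR.
Qed.

(** Self-adjointness of d(A) gives |(dr)(A)v|^2 = <r(A)v, (d^2 r)(A)v> = 0 for every v. *)
Lemma lfun_horner_sqr_eq0 (d r : {poly R}) :
  lfun_horner A (d ^+ 2 * r) = 0 -> lfun_horner A (d * r) = 0.
Proof.
move=> d2r0; apply/lfunP => v; rewrite lfunE /=; apply: dot_eq0.
rewrite {1}lfun_hornerM comp_lfunE lfun_horner_sym -comp_lfunE -lfun_hornerM.
by rewrite mulrA -expr2 d2r0 lfunE /= linear0r.
Qed.

(** Pairing the hypothesis at v with r(A)v gives |(dr)(A)v|^2 + b^2 |r(A)v|^2 = 0, a sum of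
    nonnegative terms. *)
Lemma lfun_horner_sqrD_eq0 (d r : {poly R}) (b : R) : b != 0 ->
  lfun_horner A ((d ^+ 2 + (b ^+ 2)%:P) * r) = 0 -> lfun_horner A r = 0.
Proof.
move=> b_neq0 dr0; apply/lfunP => v; rewrite lfunE /=; apply: dot_eq0.
have : dV (lfun_horner A r v)
          (lfun_horner A ((d ^+ 2 + (b ^+ 2)%:P) * r) v) = 0.
  by rewrite dr0 lfunE /= linear0r.
rewrite mulrDl lfun_hornerD lfunE /= linearDr /= expr2 -mulrA.
rewrite [lfun_horner A (d * _)]lfun_hornerM comp_lfunE -lfun_horner_sym.
rewrite -comp_lfunE -lfun_hornerM mul_polyC lfun_hornerZ lfunE /= linearZr_LR /=.
move/eqP; rewrite paddr_eq0 ?dot_ge0 //;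
  last by rewrite mulr_ge0 ?sqr_ge0 ?dot_ge0.
by rewrite mulf_eq0 sqrf_eq0 (negbTE b_neq0) => /andP[_ /eqP].
Qed.

(* Repeated roots and nonreal pairs of roots can be dropped from an
   annihilating polynomial of [A]. *)
Lemma sym_lfun_horner_annihilator :
  exists2 s : seq R, uniq s & lfun_horner A (\prod_(x <- s) ('X - x%:P)) = 0.
Proof.
have [p p_neq0 p0] := lfun_horner_annihilator A.
have : lfun_horner A (p * \prod_(x <- [::]) ('X - x%:P)) = 0.
  by rewrite big_nil mulr1.
have : uniq ([::] : seq R) by [].
(* Generalising the list gives the invariant: [p] times the product over the distinct entries of [s]
   annihilates [A]. Each round strips a factor from [p] and moves at most one new root to [s]. *)
move: {p0} [::] => s s_uniq.
have [n] := ubnP (size p).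
elim: n => // n IH in p p_neq0 s s_uniq *; rewrite ltnS => size_p ps0.
have [/size1_polyC p_cst|p_gt1] := leqP (size p) 1.
  exists s => //; move: ps0 p_neq0; rewrite p_cst polyC_eq0 mul_polyC lfun_hornerZ.
  by move/eqP; rewrite scaler_eq0 => /orP[->//|/eqP].
have [a [b [q p_def]]] := real_poly_factor p_gt1.
have q_neq0 : q != 0.
  by apply: contraNneq p_neq0 => q0; case: p_def => [|[_]] ->; rewrite q0 mul0r.
case: p_def => [p_def|[b_neq0 p_def]]; rewrite p_def in ps0 size_p.
  have size_q : (size q < n)%N.
    apply: leq_trans size_p.
    by rewrite size_Mmonic ?monicXsubC ?size_XsubC ?addn2.
  have [a_s|a_s] := boolP (a \in s).
    (* The annihilating product now contains (X - a)^2, and one of the two factors is dropped. *)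
    apply: (IH q q_neq0 s) => //; move: ps0.
    rewrite (big_rem a) //= => ps0.
    rewrite mulrCA; apply: lfun_horner_sqr_eq0; rewrite -ps0; congr lfun_horner.
    by ring.
  apply: (IH q q_neq0 (a :: s)); rewrite ?cons_uniq ?a_s //.
  by rewrite big_cons mulrA.
apply: (IH q q_neq0 s) => //; last first.
  apply: (@lfun_horner_sqrD_eq0 ('X - a%:P) _ b) => //.
  by rewrite mulrA [_ * q]mulrC.
apply: leq_trans size_p.
rewrite size_mul -?size_poly_gt0 ?size_XsubC_sqrD ?size_poly_gt0 //.
by rewrite addn3 /= ltnW.
Qed.

End SelfAdjoint.

(** * Composition with sums, and matching of indexed families *)

Section SumComp.

Variables (R : fieldType) (T V U : vectType R).
Variables (I : Type) (s : seq I) (P : pred I).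

Lemma comp_lfun_suml (Fs : I -> 'Hom(V, U)) (G : 'Hom(T, V)) :
  ((\sum_(i <- s | P i) Fs i) \o G)%VF = \sum_(i <- s | P i) (Fs i \o G)%VF.
Proof.
apply: (big_morph (fun H => (H \o G)%VF)) => [F1 F2|]; last exact: comp_lfun0l.
exact: comp_lfunDl.
Qed.

Lemma comp_lfun_sumr (F : 'Hom(V, U)) (Gs : I -> 'Hom(T, V)) :
  (F \o \sum_(i <- s | P i) Gs i)%VF = \sum_(i <- s | P i) (F \o Gs i)%VF.
Proof.
apply: (big_morph (fun H => (F \o H)%VF)) => [G1 G2|]; last exact: comp_lfun0r.
exact: comp_lfunDr.
Qed.

End SumComp.

(* Testing against all polynomials separates the nodes [t i]. *)
Lemma horner_sum_node_eq (R : fieldType) (W : lmodType R) (k k' : nat)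
    (t : 'I_k -> R) (t' : 'I_k' -> R) (G : 'I_k -> W) (G' : 'I_k' -> W) :
  injective t -> injective t' -> (forall i, G i != 0) ->
  (forall q : {poly R},
     \sum_(i < k) q.[t i] *: G i = \sum_(j < k') q.[t' j] *: G' j) ->
  forall i, exists2 j, t' j = t i & G' j = G i.
Proof.
move=> t_inj t'_inj G_neq0 eq_sum i.
(* The Lagrange polynomial of [t i] on the nodes of both families reduces the left sum to [G i] and
   the right one to the term with [t' j = t i]; without such a [j], [G i] would be 0. *)
pose nodes := codom t ++ codom t'; have := eq_sum (node_poly nodes (t i)).
have node_t j : (node_poly nodes (t i)).[t j] = (j == i)%:R.
  by rewrite horner_node_poly ?inE ?mem_cat ?codom_f ?orbT // (inj_eq t_inj).
have node_t' j : (node_poly nodes (t i)).[t' j] = (t' j == t i)%:R.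
  by rewrite horner_node_poly // inE mem_cat codom_f !orbT.
rewrite (bigD1 i) //= node_t eqxx scale1r big1 ?addr0 => [Gi|j ji]; last first.
  by rewrite node_t (negbTE ji) scale0r.
have [/existsP[j /eqP t'j]|/existsPn no_j] := boolP [exists j, t' j == t i].
  exists j => //; rewrite Gi (bigD1 j) //= node_t' t'j eqxx scale1r big1 ?addr0 //.
  by move=> l lj; rewrite node_t' -t'j (inj_eq t'_inj) (negbTE lj) scale0r.
have := G_neq0 i; rewrite Gi big1 ?eqxx // => l _.
by rewrite node_t' (negbTE (no_j l)) scale0r.
Qed.

(** Listed by index, both families are strictly sorted; such lists with the same elements coincide,
    in length and in each entry. *)
Lemma decreasing_enum_eq (R : porderType ring_display) (k k' : nat)
    (s : 'I_k -> R) (s' : 'I_k' -> R) :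
  (forall i j : 'I_k, (i < j)%N -> s j < s i) ->
  (forall i j : 'I_k', (i < j)%N -> s' j < s' i) ->
  (forall i, exists j, s' j = s i) -> (forall j, exists i, s i = s' j) ->
  exists e : k = k', forall i, s' (cast_ord e i) = s i.
Proof.
have codom_sorted n (u : 'I_n -> R) : (forall i j : 'I_n, (i < j)%N -> u j < u i) ->
    sorted >%O (codom u).
  move=> u_decr; rewrite codomE sorted_map.
  have : sorted ltn (map val (enum 'I_n)) by rewrite val_enum_ord iota_ltn_sorted.
  by rewrite sorted_map; apply: sub_sorted => i j /=; apply: u_decr.
move=> s_decr s'_decr ss' s's.
have eq_codom : codom s = codom s'.
  apply: (@irr_sorted_eq _ >%O) (codom_sorted _ _ s_decr)
    (codom_sorted _ _ s'_decr) _.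
  - by move=> y x z /= yx zy; apply: lt_trans yx.
  - by move=> x /=; rewrite ltxx.
  move=> x; apply/codomP/codomP => -[i ->].
    by have [j] := ss' i; exists j.
  by have [j] := s's i; exists j.
have e : k = k'.
  by have := congr1 size eq_codom; rewrite !size_codom !card_ord.
(* Once [s'] is generalised, [k'] can be replaced by [k] and the cast disappears. *)
exists e => i; move: s' {s'_decr ss' s's} eq_codom; case: k' / e => s' eq_s.
rewrite cast_ord_id; apply/esym; move: eq_s; rewrite !codomE => /eq_in_map; apply.
by rewrite mem_enum.
Qed.

(** * Adjoints and the algebra of a singular value decomposition *)

Section SVD.

Variables (R : realType) (V U : vectType R).
Variables (dV : {dot V for idfun}) (dU : {dot U for idfun}).
Implicit Types (F G : 'Hom(V, U)) (q : {poly R}).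

Local Notation adj := (adjoint dV dU).

Lemma adjointPr F v u : dU u (F v) = dV (adj F u) v.
Proof. by rewrite dotC (adjointP dV) dotC. Qed.

Lemma adjointZ c F : adj (c *: F) = c *: adj F.
Proof.
apply/esym/adjoint_uniq => v u.
by rewrite !lfunE /= linearZl_LR linearZr_LR /= (adjointP dV).
Qed.

Lemma adjoint_sum (I : Type) (s : seq I) (P : pred I) (Fs : I -> 'Hom(V, U)) :
  adj (\sum_(i <- s | P i) Fs i) = \sum_(i <- s | P i) adj (Fs i).
Proof.
apply/esym/adjoint_uniq => v u; rewrite !sum_lfunE dotC !raddf_sum /=.
by apply: eq_bigr => i _; rewrite adjointPr dotC.
Qed.

Lemma gram_sym F x y :
  dV ((adj F \o F)%VF x) y = dV x ((adj F \o F)%VF y).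
Proof. by rewrite !comp_lfunE -adjointPr (adjointP dV). Qed.

(** Any polynomial in F^t F is self-adjoint. *)
Lemma adjoint_comp_gram_horner F q :
  adj (F \o lfun_horner (adj F \o F) q)%VF =
  (lfun_horner (adj F \o F) q \o adj F)%VF.
Proof.
apply/esym/adjoint_uniq => v u; rewrite !comp_lfunE (adjointP dV).
exact: (lfun_horner_sym (@gram_sym F)).
Qed.

(** Trades the isometry condition for an equation suited to computation. Its adjoint F^t F F^t = F^t
    makes F^t F the identity on Im(F^t), and inner products are preserved there because <Fx, Fy> =
    <x, F^t F y>. *)
Lemma isometry_with_inverseP F :
  isometry_with_inverse dV dU (limg (adj F)) (limg F) F (adj F) <->
  (F \o adj F \o F)%VF = F.
Proof.
split=> [[_ _ _ adjFK _]|FF].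
  apply/lfunP => v; rewrite !comp_lfunE adjFK //.
  by rewrite memv_img ?memvf.
have adjFF : (adj F \o F \o adj F)%VF = adj F.
  apply: adjoint_uniq => v u; rewrite !comp_lfunE -{1}FF !comp_lfunE.
  by rewrite (adjointP dV) -adjointPr (adjointP dV).
have FFE v : F (adj F (F v)) = F v by rewrite -[in RHS]FF !comp_lfunE.
have adjFFE u : adj F (F (adj F u)) = adj F u by rewrite -[in RHS]adjFF !comp_lfunE.
split.
- apply/eqP; rewrite eqEsubv limgS ?subvf //=; apply/subvP => _ /memv_imgP[v _ ->].
  by rewrite -FFE !memv_img ?memvf.
- apply/eqP; rewrite eqEsubv limgS ?subvf //=; apply/subvP => _ /memv_imgP[v _ ->].
  by rewrite -adjFFE !memv_img ?memvf.
- by move=> _ /memv_imgP[u _ ->]; rewrite adjFFE.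
- by move=> _ /memv_imgP[v _ ->]; rewrite FFE.
move=> _ _ /memv_imgP[u _ ->] /memv_imgP[w _ ->].
by apply: etrans (adjointP dV dU F _ _) _; rewrite adjFFE.
Qed.

(** Cross terms vanish by orthogonality, so F_i F^t F = sigma_i^2 F_i F_i^t F_i = sigma_i^2 F_i. The
    left side involves [F] alone, which is what drives uniqueness. *)
Lemma svd_comp_gram_horner F k (sigma : 'I_k -> R) (Fs : 'I_k -> 'Hom(V, U)) q :
  is_svd dV dU F sigma Fs ->
  (F \o lfun_horner (adj F \o F) q)%VF =
  \sum_(i < k) q.[sigma i ^+ 2] *: (sigma i *: Fs i).
Proof.
case=> F_def _ _ Fs_orth Fs_iso.
have adjF : adj F = \sum_i sigma i *: adj (Fs i).
  by rewrite F_def adjoint_sum; under eq_bigr do rewrite adjointZ.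
have adjFF i : (adj (Fs i) \o F)%VF = sigma i *: (adj (Fs i) \o Fs i)%VF.
  rewrite F_def comp_lfun_sumr (bigD1 i) //= -comp_lfunZr big1 ?addr0 // => j ji.
  by rewrite -comp_lfunZr (Fs_orth i j _).2 ?scaler0 // eq_sym.
have FadjF i : (Fs i \o adj F)%VF = sigma i *: (Fs i \o adj (Fs i))%VF.
  rewrite adjF comp_lfun_sumr (bigD1 i) //= -comp_lfunZr big1 ?addr0 // => j ji.
  by rewrite -comp_lfunZr (Fs_orth i j _).1 ?scaler0 // eq_sym.
have Fs_gram i : (Fs i \o (adj F \o F))%VF = sigma i ^+ 2 *: Fs i.
  rewrite comp_lfunA FadjF -comp_lfunZl -comp_lfunA adjFF -comp_lfunZr comp_lfunA.
  by rewrite (isometry_with_inverseP _).1 // scalerA -expr2.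
rewrite {1}F_def comp_lfun_suml; apply: eq_bigr => i _.
by rewrite -comp_lfunZl (comp_lfun_horner _ (Fs_gram i)) scalerA mulrC -scalerA.
Qed.

(** * Existence of the decomposition *)

(** Choose v with F G v nonzero: then 0 < |F G v|^2 = <G v, F^t F G v> = t |G v|^2. *)
Lemma gram_eigenvalue_gt0 F (G : 'End(V)) (t : R) :
  ((adj F \o F) \o G)%VF = t *: G -> (F \o G)%VF != 0 -> 0 < t.
Proof.
move=> AG FG; have [v FGv] : exists v, F (G v) != 0.
  apply: boolp.contrapT => no_v; case/eqP: FG; apply/lfunP => v.
  rewrite comp_lfunE lfunE /=; apply/eqP; apply: boolp.contrapT => FGv.
  by apply: no_v; exists v; apply/negP.
have : 0 < dU (F (G v)) (F (G v)) by exact: neq0_dnorm_gt0.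
have -> : dU (F (G v)) (F (G v)) = t * dV (G v) (G v).
  rewrite (adjointP dV) -[adj F _]comp_lfunE -comp_lfunE AG lfunE /=.
  exact: linearZr_LR.
apply: contraLR; rewrite -!leNgt => t_le0.
by rewrite mulr_le0_ge0 // dot_ge0.
Qed.

Lemma svd_exists F :
  exists (k : nat) (sigma : 'I_k -> R) (Fs : 'I_k -> 'Hom(V, U)),
    is_svd dV dU F sigma Fs.
Proof.
set A := (adj F \o F)%VF.
have [s s_uniq As0] := sym_lfun_horner_annihilator (@gram_sym F).
rewrite -/A in As0.
have eq_horner := eq_lfun_horner s_uniq As0.
have nodeE x t : x \in s -> (node_poly s t).[x] = (x == t)%:R.
  by move=> xs; rewrite horner_node_poly // inE xs orbT.
pose P t := lfun_horner A (node_poly s t).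
(* This identity and the next two each compare two polynomials that agree on [s]. *)
have AP t : (A \o P t)%VF = t *: P t.
  rewrite -{1}[A]lfun_hornerX -lfun_hornerM -lfun_hornerZ.
  apply: eq_horner => x xs; rewrite !hornerE nodeE //.
  by case: eqP => [->//|_]; rewrite !mulr0.
have PP t u : (P t \o P u)%VF = (t == u)%:R *: P t.
  rewrite -lfun_hornerM -lfun_hornerZ; apply: eq_horner => x xs.
  rewrite !hornerE !nodeE //; case: (eqVneq x t) => [->|_];
    last by rewrite mul0r mulr0.
  by rewrite mul1r mulr1.
have sumP : \sum_(t <- s) P t = \1%VF.
  rewrite -lfun_horner_sum -[\1%VF]scale1r -(lfun_hornerC A).
  apply: eq_horner => x xs; rewrite horner_sum hornerC.
  rewrite (bigD1_seq x) //= nodeE // eqxx big1 ?addr0 // => t tx.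
  by rewrite nodeE // eq_sym (negbTE tx).
(* The nonzero eigenvalues of F^t F in decreasing order: the filter drops 0 and the nodes that are
   not eigenvalues. *)
pose s' : seq R := rev (sort <=%R [seq t <- s | (F \o P t)%VF != 0]).
have s'_uniq : uniq s' by rewrite rev_uniq sort_uniq filter_uniq.
have s'_sorted : sorted >%R s'.
  by rewrite rev_sorted sort_lt_sorted filter_uniq.
have s'P i : (i < size s')%N -> 0 < s'`_i /\ (F \o P s'`_i)%VF != 0.
  move=> /(mem_nth 0); rewrite mem_rev mem_sort mem_filter => /andP[FP _].
  by split=> //; apply: gram_eigenvalue_gt0 FP; apply: AP.
pose sigma (i : 'I_(size s')) : R := Num.sqrt s'`_i.
pose Fs (i : 'I_(size s')) : 'Hom(V, U) := (sigma i)^-1 *: (F \o P s'`_i)%VF.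
have sigma_gt0 i : 0 < sigma i by rewrite sqrtr_gt0; case: (s'P i (ltn_ord i)).
have sigmaE (i : 'I_(size s')) : s'`_i = sigma i ^+ 2.
  by rewrite sqr_sqrtr // ltW //; case: (s'P i (ltn_ord i)).
have adjFs (i : 'I_(size s')) : adj (Fs i) = (sigma i)^-1 *: (P s'`_i \o adj F)%VF.
  by rewrite adjointZ adjoint_comp_gram_horner.
have PPne (i j : 'I_(size s')) : i != j -> (P s'`_i \o P s'`_j)%VF = 0.
  by move=> ij; rewrite PP nth_uniq // (inj_eq val_inj) (negbTE ij) scale0r.
exists (size s'), sigma, Fs; split.
(* Expand F as the sum of the F P_t over [s], discard the zero terms and reindex the others by
   [s']. *)
- rewrite -{1}[F]comp_lfun1r -sumP comp_lfun_sumr.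
  rewrite (bigID (fun t => (F \o P t)%VF == 0)) /= big1 ?add0r => [|t /eqP//].
  rewrite -big_filter (perm_big s') /=; last first.
    by rewrite perm_sym perm_rev perm_sort.
  rewrite (big_nth 0) big_mkord.
  apply: eq_bigr => i _; rewrite scalerA divff ?scale1r // gt_eqF //.
- move=> i j ij; rewrite ltr_sqrt; last by case: (s'P i (ltn_ord i)).
  have gt_trans : transitive (>%R : rel R).
    by move=> y x z /= yx zy; apply: lt_trans yx.
  exact: (sorted_ltn_nth gt_trans 0 s'_sorted _ _ (ltn_ord i) (ltn_ord j) ij).
- move=> i; split=> //; rewrite scaler_eq0 negb_or invr_eq0 gt_eqF ?sigma_gt0 //=.
  by case: (s'P i (ltn_ord i)).
(* Up to scalars the products are F P_i P_j F^t and P_i A P_j = t_j P_i P_j, and P_i P_j = 0. *)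
- move=> i j ij; rewrite !adjFs; split.
    rewrite -comp_lfunZl -comp_lfunZr comp_lfunA -(comp_lfunA F) PPne //.
    by rewrite comp_lfun0r comp_lfun0l !scaler0.
  rewrite -comp_lfunZl -comp_lfunZr comp_lfunA -(comp_lfunA _ (adj F)).
  by rewrite -comp_lfunA AP -comp_lfunZr PPne // !scaler0.
move=> i; apply/isometry_with_inverseP; rewrite adjFs.
rewrite -!(comp_lfunZl, comp_lfunZr).
(* With t = sigma_i^2, the product F_i F_i^t F_i is sigma_i^(-3) F P P A P = sigma_i^(-3) t F P =
   F_i. *)
have -> : (F \o P s'`_i \o (P s'`_i \o adj F) \o (F \o P s'`_i))%VF =
    (F \o (P s'`_i \o P s'`_i) \o (A \o P s'`_i))%VF by rewrite !comp_lfunA.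
rewrite PP eqxx scale1r AP -comp_lfunZr -comp_lfunA PP eqxx scale1r.
rewrite !scalerA; congr (_ *: _); rewrite sigmaE.
by field; rewrite gt_eqF.
Qed.

(** * Uniqueness of the decomposition *)

(** Both decompositions yield the same sums F q(F^t F) for all q, so their terms correspond; the
    decreasing order makes the correspondence respect indices. *)
Lemma svd_unique F k (sigma : 'I_k -> R) (Fs : 'I_k -> 'Hom(V, U))
    k' (sigma' : 'I_k' -> R) (Fs' : 'I_k' -> 'Hom(V, U)) :
  is_svd dV dU F sigma Fs -> is_svd dV dU F sigma' Fs' ->
  exists e : k = k', forall i,
    sigma' (cast_ord e i) = sigma i /\ Fs' (cast_ord e i) = Fs i.
Proof.
have decr_inj n (s : 'I_n -> R) : (forall i j : 'I_n, (i < j)%N -> s j < s i) ->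
    injective s.
  move=> s_decr i j eq_s; apply: val_inj.
  by case: (ltngtP i j) => // /s_decr; rewrite eq_s ltxx.
have match_term n (s : 'I_n -> R) (G : 'I_n -> 'Hom(V, U))
    n' (s' : 'I_n' -> R) (G' : 'I_n' -> 'Hom(V, U)) :
  is_svd dV dU F s G -> is_svd dV dU F s' G' ->
  forall i, exists2 j, s' j = s i & G' j = G i.
  move=> svd svd' i.
  have [_ s_decr s_pos _ _] := svd; have [_ s'_decr s'_pos _ _] := svd'.
  have sqr_inj m (u : 'I_m -> R) (u_decr : forall i j : 'I_m, (i < j)%N -> u j < u i) :
      (forall i, 0 < u i) -> injective (fun i => u i ^+ 2).
    move=> u_gt0 a b /eqP; rewrite eqrXn2 ?ltW // => /eqP; exact: decr_inj.
  (* The nodes are squares of distinct positive numbers, hence distinct; the terms [s i *: G i] are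
     nonzero because both factors are. *)
  have [||||j /eqP] := @horner_sum_node_eq _ _ _ _ (fun i => s i ^+ 2)
    (fun i => s' i ^+ 2) (fun i => s i *: G i) (fun i => s' i *: G' i) _ _ _ _ i.
  - by apply: sqr_inj => // a; case: (s_pos a).
  - by apply: sqr_inj => // a; case: (s'_pos a).
  - move=> a; have [sa_gt0 Ga] := s_pos a.
    by rewrite scaler_eq0 negb_or Ga andbT gt_eqF.
  - by move=> q; rewrite -(svd_comp_gram_horner q svd) -(svd_comp_gram_horner q svd').
  have [si_gt0 _] := s_pos i; have [s'j_gt0 _] := s'_pos j.
  (* Positivity recovers the singular value from its square, and this nonzero scalar is then
     cancelled from the terms. *)
  rewrite eqrXn2 ?ltW // => /eqP eq_s; rewrite eq_s => /scalerI eq_G.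
  by exists j => //; apply: eq_G; rewrite gt_eqF.
move=> svd svd'.
have [_ s_decr _ _ _] := svd; have [_ s'_decr _ _ _] := svd'.
have [i|j|e eq_s] := decreasing_enum_eq s_decr s'_decr.
- by have [j] := match_term _ _ _ _ _ _ svd svd' i; exists j.
- by have [l] := match_term _ _ _ _ _ _ svd' svd j; exists l.
exists e => i; split=> //.
(* The matching [j] must be [cast_ord e i], as the injective [sigma'] takes the same value at
   both. *)
have [j eq_sj <-] := match_term _ _ _ _ _ _ svd svd' i.
by congr Fs'; apply: (decr_inj _ sigma' s'_decr); rewrite eq_s.
Qed.

End SVD.

Unset Implicit Arguments.

Theorem theorem3p4 (R : realType) (V U : vectType R)
    (dV : {dot V for idfun}) (dU : {dot U for idfun}) (F : 'Hom(V, U)) :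
  exists (k : nat) (sigma : 'I_k -> R) (Fs : 'I_k -> 'Hom(V, U)),
    is_svd dV dU F sigma Fs /\
    forall (k' : nat) (sigma' : 'I_k' -> R) (Fs' : 'I_k' -> 'Hom(V, U)),
      is_svd dV dU F sigma' Fs' ->
      exists e : k = k',
        forall i : 'I_k,
          sigma' (cast_ord e i) = sigma i /\ Fs' (cast_ord e i) = Fs i.
Proof.
have [k [sigma [Fs svd]]] := svd_exists dV dU F.
exists k, sigma, Fs; split=> // k' sigma' Fs' svd'.
exact: svd_unique svd svd'.
Qed.
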